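(* Let $G$ be a group and let $R$ be a $G$-graded ring. If $(R,G)$ is first strong, then $(R,G)$ is weak.
   Context: A ring $R$ with unity $1$ is $G$-graded if $R=\bigoplus_{g\in G}R_g$ for additive subgroups $R_g$ with $R_gR_h\subseteq R_{gh}$ for all $g,h\in G$, where $R_gR_h$ denotes the additive subgroup generated by the products $ab$, $a\in R_g$, $b\in R_h$. $supp(R,G)=\{g\in G:R_g\neq\{0\}\}$. $(R,G)$ is first strong if $1\in R_gR_{g^{-1}}$ for all $g\in supp(R,G)$. $(R,G)$ is weak if for every $g\in G$, $R_g=\{0\}$ implies $R_{g^{-1}}=\{0\}$. *)

(* Defs.v *)
From HB Require Import structures.
From mathcomp Require Import all_boot all_order all_algebra.
From mathcomp Require Import boolp classical_sets functions cardinality fsbigop.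

Set Implicit Arguments.
Unset Strict Implicit.
Unset Printing Implicit Defensive.

Import GRing.Theory.
Local Open Scope ring_scope.
Local Open Scope classical_set_scope.

Definition additive_subgroup (R : pzRingType) (M : set R) : Prop :=
  M 0 /\ (forall x y, M x -> M y -> M (x - y)).

(* The product AB of graded pieces: the additive subgroup generated by the
   products, not merely the set of products. *)
Definition set_mul (R : pzRingType) (A B : set R) : set R :=
  smallest (@additive_subgroup R) [set x * y | x in A & y in B].

(* R is the internal direct sum of the A g. Finiteness of the support of f has
   to be required, since \sum_(g \in _) is 0 by convention otherwise. *)
Definition direct_sum_decomposition (I : choiceType) (R : pzRingType)
    (A : I -> set R) : Prop :=
  forall r : R, exists! f : I -> R,
    [/\ forall i, A i (f i),
        finite_set [set i | f i <> 0]
      & r = \sum_(i \in [set: I]) f i].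

Record graded (G : groupType) (R : pzRingType) (A : G -> set R) : Prop := {
  graded_subgroup : forall g, additive_subgroup (A g);
  graded_direct : direct_sum_decomposition A;
  graded_mul : forall g h, set_mul (A g) (A h) `<=` A (g * h)%g
}.

Definition grading_supp (G : groupType) (R : pzRingType) (A : G -> set R) :
    set G :=
  [set g | A g <> [set 0]].

Definition first_strong (G : groupType) (R : pzRingType) (A : G -> set R) :
    Prop :=
  forall g, grading_supp A g -> set_mul (A g) (A (g^-1)%g) 1.

Definition weak_graded (G : groupType) (R : pzRingType) (A : G -> set R) :
    Prop :=
  forall g, A g = [set 0] -> A (g^-1)%g = [set 0].

(* Main.v *)
Require Import Defs.
From mathcomp Require Import all_boot all_order all_algebra.
From mathcomp Require Import boolp classical_sets functions cardinality fsbigop.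

(** If [A g] is zero but [A g^-1] is not, first strength at [g^-1] puts 1 in the product of [A g^-1]
    with the zero subgroup, which is zero by [set_mulx0]. Hence 1 = 0 and the whole ring collapses,
    including [A g^-1]. *)

Lemma set_mulx0 (R : pzRingType) (M : set R) :
  (set_mul M [set 0%R] `<=` [set 0%R])%classic.
Proof.
apply: smallest_sub; first by split=> // _ _ -> ->; rewrite /= GRing.subr0.
by move=> _ [x _ [_ -> <-]]; rewrite /= GRing.mulr0.
Qed.

Theorem corollary2p16 (G : groupType) (R : pzRingType) (A : G -> set R)
    (gradedA : graded A) (strongA : first_strong A) : weak_graded A.
Proof.
move=> g Ag0; apply: contrapT => AgV_neq0; apply: (AgV_neq0).
have := strongA _ AgV_neq0; rewrite invgK Ag0 => /set_mulx0 /= one_eq0.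
(* A [pzRingType] may be the zero ring, so 1 = 0 is not absurd in itself; the contradiction is that
   it forces [A g^-1] to be zero. *)
have trivR (x : R) : x = 0%R by rewrite -[x]GRing.mulr1 one_eq0 GRing.mulr0.
have [AgV0 _] := @graded_subgroup _ _ _ gradedA (g^-1)%g.
by apply/seteqP; split=> x; [move=> _; apply: trivR | move=> ->].
Qed.
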